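(* Let $(I=(n,T,W),S,r)$ be a feasible ordered insert state with $S$ ordered, and let $N=\mathrm{Near}(I,S,r)$. Then $N$ is a near ordered solution for $(I,S,r)$, i.e. $N$ is an ordered solution for $I$ and $S[r-1]\le N[r]\le S[r+1]$.
   Context: Single processor, unit-length tasks. A window is a closed real interval; a slot is a closed real interval of length $1$; intervals overlap iff their interiors intersect. An instance $I=(n,T,W)$ consists of tasks $T[1..n]$ with windows $W[1..n]$. A valid allocation $S$ assigns to each $T[i]$ either a slot $S[i]\subseteq W[i]$ or $null$, with no two allocated slots overlapping; a solution allocates all tasks; $I$ is feasible iff it has a solution. An insert state $(I,S,r)$ has $S$ a valid allocation allocating all tasks except $T[r]$ ($S[r]=null$); it is feasible iff $I$ is. Intervals are partially ordered by $X\le Y$ iff $X.\mathrm{start}\le Y.\mathrm{start}$ and $X.\mathrm{end}\le Y.\mathrm{end}$; a sequence of intervals is ordered iff its non-null elements are increasing; $I$ is ordered iff $W[1..n]$ is ordered, and the insert state is ordered iff $I$ is; $S$ is ordered iff $S[1..n]$ is ordered. Convention: $S[0]=[-\infty,-\infty]$ and $S[n+1]=[+\infty,+\infty]$. $\mathrm{Leftmost}(I)$: set $L[0].\mathrm{end}=-\infty$ and for $i=1..n$, $L[i]=[\max(W[i].\mathrm{start},L[i-1].\mathrm{end}),\max(W[i].\mathrm{start},L[i-1].\mathrm{end})+1]$. $\mathrm{Near}(I,S,r)$: let $L=\mathrm{Leftmost}(I)$; if $L[r]\ge S[r-1]$ return $L$, otherwise return the sequence $L[1..r-1]$ followed by $S[r-1]$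 followed by $S[r+1..n]$. *)

(* Defs.v *)
From mathcomp Require Import all_boot all_order all_algebra.
From mathcomp Require Import all_classical all_reals all_analysis.
Import Order.TTheory GRing.Theory Num.Theory.
Import numFieldNormedType.Exports.
Set Implicit Arguments.
Unset Strict Implicit.
Unset Printing Implicit Defensive.
Local Open Scope classical_set_scope.
Local Open Scope ring_scope.

(* Endpoints are extended reals only to accommodate the sentinel intervals
   [-oo, -oo] and [+oo, +oo]; windows and slots have finite endpoints. *)
Record cinterval (R : realType) := CInterval {
  istart : \bar R;
  iend : \bar R }.

Definition ninfty_interval (R : realType) : cinterval R :=
  CInterval (-oo)%E (-oo)%E.

Definition pinfty_interval (R : realType) : cinterval R :=
  CInterval (+oo)%E (+oo)%E.

Definition points (R : realType) (X : cinterval R) : set R :=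
  [set x : R | (istart X <= x%:E)%E && (x%:E <= iend X)%E].

Definition is_window (R : realType) (X : cinterval R) : bool :=
  [&& istart X \is a fin_num, iend X \is a fin_num & (istart X <= iend X)%E].

Definition is_slot (R : realType) (X : cinterval R) : bool :=
  (istart X \is a fin_num) && (iend X == istart X + 1)%E.

Definition overlap (R : realType) (X Y : cinterval R) : Prop :=
  (interior (points X) `&` interior (points Y)) !=set0.

Definition interval_le (R : realType) (X Y : cinterval R) : bool :=
  (istart X <= istart Y)%E && (iend X <= iend Y)%E.

(* [null] is [None], and is comparable to nothing. *)
Definition ointerval_le (R : realType) (X Y : option (cinterval R)) : bool :=
  if (X, Y) is (Some X', Some Y') then interval_le X' Y' else false.

(* [pmap id] removes the null elements. *)
Definition ordered (R : realType) (s : seq (option (cinterval R))) : Prop :=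
  sorted (@interval_le R) (pmap id s).

(* 1-based access to s[1..n], n = size s, extended by the convention
   s[0] = [-oo, -oo] and s[n+1] = [+oo, +oo]. *)
Definition entry (R : realType) (s : seq (option (cinterval R))) (i : nat) :
    option (cinterval R) :=
  nth None
    (rcons (Some (ninfty_interval R) :: s) (Some (pinfty_interval R))) i.

Record instance (R : realType) (Task : Type) := Instance {
  ntasks : nat;
  tasks : ntasks.-tuple Task;
  windows : ntasks.-tuple (cinterval R);
  windowsP : all (@is_window R) windows }.

Definition window_seq (R : realType) (Task : Type) (I : instance R Task) :
    seq (option (cinterval R)) :=
  [seq Some w | w <- windows I].

Definition ordered_instance (R : realType) (Task : Type)
    (I : instance R Task) : Prop :=
  ordered (window_seq I).

Definition valid_allocation (R : realType) (Task : Type) (I : instance R Task)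
    (S : seq (option (cinterval R))) : Prop :=
  [/\ size S = ntasks I,
      (forall (i : nat) (X w : cinterval R), (1 <= i <= ntasks I)%N ->
         entry S i = Some X -> entry (window_seq I) i = Some w ->
         is_slot X /\ points X `<=` points w)
    & (forall (i j : nat) (X Y : cinterval R),
         (1 <= i <= ntasks I)%N -> (1 <= j <= ntasks I)%N -> i <> j ->
         entry S i = Some X -> entry S j = Some Y -> ~ overlap X Y)].

Definition solution (R : realType) (Task : Type) (I : instance R Task)
    (S : seq (option (cinterval R))) : Prop :=
  valid_allocation I S /\
  (forall i : nat, (1 <= i <= ntasks I)%N -> entry S i <> None).

Definition feasible (R : realType) (Task : Type) (I : instance R Task) : Prop :=
  exists S : seq (option (cinterval R)), solution I S.

Definition insert_state (R : realType) (Task : Type) (I : instance R Task)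
    (S : seq (option (cinterval R))) (r : nat) : Prop :=
  [/\ valid_allocation I S,
      (1 <= r <= ntasks I)%N
    & (forall i : nat, (1 <= i <= ntasks I)%N -> entry S i = None <-> i = r)].

Definition leftmost_step (R : realType) (P w : cinterval R) : cinterval R :=
  let s := maxe (istart w) (iend P) in CInterval s (s + 1)%E.

(* [scanl] yields L[1..n], starting from L[0] = [-oo, -oo]. *)
Definition leftmost (R : realType) (Task : Type) (I : instance R Task) :
    seq (option (cinterval R)) :=
  [seq Some X
  | X <- scanl (@leftmost_step R) (ninfty_interval R) (windows I)].

Definition near_allocation (R : realType) (Task : Type) (I : instance R Task)
    (S : seq (option (cinterval R))) (r : nat) : seq (option (cinterval R)) :=
  let L := leftmost I in
  if ointerval_le (entry S r.-1) (entry L r) then L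
  else take r.-1 L ++ entry S r.-1 :: drop r S.

Definition near_ordered_solution (R : realType) (Task : Type)
    (I : instance R Task) (S : seq (option (cinterval R))) (r : nat)
    (N : seq (option (cinterval R))) : Prop :=
  [/\ solution I N,
      ordered N,
      ointerval_le (entry S r.-1) (entry N r)
    & ointerval_le (entry N r) (entry S r.+1)].

(* Main.v *)
(* Leftmost is a solution: a left-packed run of slots ending at task [k] starts
   at the opening of some window [j], and tasks [j..k], being schedulable inside
   [W[j].start, W[k].end], leave room for it. It also lies below every ordered
   allocation of a prefix, so [L[r-1] <= S[r-1]] and hence [L[r] <= S[r+1]].
   When [L[r] < S[r-1]], the slot [S[r-1]] lies after [L[r-1]] and starts after
   [W[r].start], so task [r] can take it over from task [r-1]. *)
Require Import Defs.
From mathcomp Require Import all_boot all_order all_algebra.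
From mathcomp Require Import all_classical all_reals all_analysis.
From mathcomp Require Import zify lra.
Import Order.TTheory GRing.Theory Num.Theory.
Set Implicit Arguments.
Unset Strict Implicit.
Unset Printing Implicit Defensive.
Local Open Scope ring_scope.

(** * Left-packed start times *)

(* Choosing one point [f i], those below it fit in [[lo, f i]] and those above
   it in [[f i + 1, hi]]. *)
Lemma packing (R : realFieldType) (T : eqType) (f : T -> R) (s : seq T)
    (lo hi : R) :
  uniq s -> lo <= hi ->
  {in s, forall i, lo <= f i /\ f i + 1 <= hi} ->
  {in s &, forall i j, i != j -> f i + 1 <= f j \/ f j + 1 <= f i} ->
  lo + (size s)%:R <= hi.
Proof.
have [m] := ubnP (size s); elim: m s lo hi => // m IHm [|i s] lo hi.
  by rewrite addr0.
rewrite ltnS => le_s_m /= /andP[iNs uniq_s] le_lo_hi inb sep.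
have [lo_i i_hi] := inb i (mem_head i s).
set below := fun j => f j < f i.
have size_part (p : pred T) : (size (seq.filter p s) < m)%N.
  by apply: leq_trans le_s_m; rewrite ltnS size_filter count_size.
have sep_s : {in s &, forall j k, j != k -> f j + 1 <= f k \/ f k + 1 <= f j}.
  by move=> j k js ks; apply: sep; rewrite in_cons ?js ?ks orbT.
have sep_i j : j \in s -> f i + 1 <= f j \/ f j + 1 <= f i.
  move=> js; apply: sep; rewrite ?in_cons ?eqxx ?js ?orbT //.
  by apply: contraNneq iNs => ->.
have inb_s j : j \in s -> lo <= f j /\ f j + 1 <= hi.
  by move=> js; apply: inb; rewrite in_cons js orbT.
have left_part : lo + (size (seq.filter below s))%:R <= f i.
  apply: IHm; rewrite ?filter_uniq //.
    move=> j; rewrite mem_filter => /andP[fji js].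
    by have [lo_j _] := inb_s j js; case: (sep_i j js); rewrite /below in fji; lra.
  by move=> j k; rewrite !mem_filter => /andP[_ js] /andP[_ ks]; apply: sep_s.
have right_part : f i + 1 + (size (seq.filter (predC below) s))%:R <= hi.
  apply: IHm; rewrite ?filter_uniq //.
    move=> j; rewrite mem_filter => /andP[/=]; rewrite -leNgt => fij js.
    by have [_ j_hi] := inb_s j js; case: (sep_i j js); lra.
  by move=> j k; rewrite !mem_filter => /andP[_ js] /andP[_ ks]; apply: sep_s.
have -> : (size s).+1%:R = 1 + (size (seq.filter below s))%:R
    + (size (seq.filter (predC below) s))%:R :> R.
  by rewrite -(count_predC below s) !size_filter -addn1 !natrD; lra.
lra.
Qed.

Section Earliest.
Variables (R : realFieldType) (a : nat -> R).

(** Start times of Leftmost, indexed from 0; at 0 the maximum with [L[0].end = -oo] reduces to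
    [a 0]. *)
Fixpoint earliest (k : nat) : R :=
  if k is k'.+1 then Num.max (a k) (earliest k' + 1) else a 0%N.

Lemma earliest_ge k : a k <= earliest k.
Proof. by case: k => [|k] /=; rewrite ?le_max lexx. Qed.

Lemma earliest_step k : earliest k + 1 <= earliest k.+1.
Proof. by rewrite /= le_max lexx orbT. Qed.

(** Each step either opens a new run at [k.+1], when [a k.+1] is the larger, or lengthens the
    current run by one slot. *)
Lemma earliest_block k :
  exists2 j, (j <= k)%N & earliest k = a j + (k - j)%:R.
Proof.
elim: k => [|k [j le_jk IHk]]; first by exists 0%N; rewrite ?addr0.
rewrite /=; case: (leP (a k.+1) (earliest k + 1)) => _.
  by exists j; rewrite ?(leqW le_jk) // IHk subSn // -addrA -natr1.
by exists k.+1; rewrite // subnn addr0.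
Qed.

(** Left packing is minimal: both arguments of the maximum stay below [s k]. Only indices up to [k]
    matter, so this applies to the part of [S] before its null entry. *)
Lemma earliest_le (s : nat -> R) k :
  (forall i, (i <= k)%N -> a i <= s i) ->
  (forall i, (i < k)%N -> s i + 1 <= s i.+1) -> earliest k <= s k.
Proof.
elim: k => [|k IHk] as_ ss /=; first exact: as_.
rewrite ge_max as_ //=; apply: le_trans (ss k _) => //.
by rewrite lerD2r IHk // => i ik; [apply: as_ | apply: ss]; lia.
Qed.

(* A left-packed run starts at the opening time of some window [j], and the
   tasks [j..k] occupy [k - j + 1] disjoint slots in [[a j, b k]] in any
   solution. *)
Lemma earliest_fits (b f : nat -> R) n k :
  (forall i j, (i <= j < n)%N -> a i <= a j /\ b i <= b j) ->
  (forall i, (i < n)%N -> a i <= f i /\ f i + 1 <= b i) ->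
  (forall i j, (i < n)%N -> (j < n)%N -> i != j ->
     f i + 1 <= f j \/ f j + 1 <= f i) ->
  (k < n)%N -> earliest k + 1 <= b k.
Proof.
move=> ab_homo f_in f_sep lt_kn; have [j le_jk ->] := earliest_block k.
rewrite -addrA natr1 -subSn // -(size_iota j (k.+1 - j)).
apply: (packing (f := f)).
- exact: iota_uniq.
- have [ajk _] := ab_homo j k ltac:(lia).
  by have := f_in k lt_kn; lra.
- move=> i; rewrite mem_iota => i_jk.
  have [aji _] := ab_homo j i ltac:(lia).
  have [_ bik] := ab_homo i k ltac:(lia).
  by have := f_in i ltac:(lia); lra.
- by move=> i i'; rewrite !mem_iota => ? ?; apply: f_sep; lia.
Qed.

End Earliest.

(** * Slots and allocations as real start times *)

Definition slot_at (R : realType) (x : R) : cinterval R :=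
  CInterval x%:E (x + 1)%:E.

Lemma is_slotP (R : realType) (X : cinterval R) :
  reflect (exists x, X = slot_at x) (is_slot X).
Proof.
apply: (iffP andP) => [|[x ->]]; last by rewrite /= -EFinD.
by case: X => s e /= [/EFin_fin_numP[x ->] /eqP ->]; exists x.
Qed.

Lemma interval_le_slot (R : realType) (x y : R) :
  interval_le (slot_at x) (slot_at y) = (x <= y).
Proof. by rewrite /interval_le /= !lee_fin lerD2r andbb. Qed.

Lemma interval_le_trans (R : realType) : transitive (@interval_le R).
Proof.
move=> Y X Z /andP[sXY eXY] /andP[sYZ eYZ].
by rewrite /interval_le (le_trans sXY) ?(le_trans eXY).
Qed.

Lemma points_slot (R : realType) (x : R) :
  points (slot_at x) = `[x, x + 1]%classic.
Proof. by apply/seteqP; split=> y; rewrite /points /= !lee_fin in_itv. Qed.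

Lemma overlap_slot (R : realType) (x y : R) :
  overlap (slot_at x) (slot_at y) <-> y < x + 1 /\ x < y + 1.
Proof.
rewrite /overlap !points_slot !interior_itv; split.
  by case=> z []; rewrite /= !in_itv /= => /andP[? ?] /andP[? ?]; split; lra.
(* The witness is the common midpoint of [[x, y + 1]] and [[y, x + 1]]. *)
case=> yx xy; exists ((x + y + 1) / 2).
by split; rewrite /= in_itv /=; apply/andP; split; lra.
Qed.

(** A closed slot contains its endpoints, so inclusion can be tested on them alone. *)
Lemma points_slot_sub (R : realType) (x : R) (w : cinterval R) :
  (points (slot_at x) `<=` points w)%classic <->
  (istart w <= x%:E)%E /\ ((x + 1)%:E <= iend w)%E.
Proof.
split=> [sub|[sw we] y]; last first.
  rewrite points_slot /points /= in_itv /= => /andP[xy yx].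
  by rewrite (le_trans sw) ?lee_fin //= (le_trans _ we) ?lee_fin.
have /andP[sx _] : points w x.
  by apply: sub; rewrite points_slot /= in_itv /=; apply/andP; split; lra.
have /andP[_ xe] : points w (x + 1).
  by apply: sub; rewrite points_slot /= in_itv /=; apply/andP; split; lra.
by [].
Qed.

Lemma entryS (R : realType) (s : seq (option (cinterval R))) k :
  (k < size s)%N -> entry s k.+1 = nth None s k.
Proof. by move=> ks; rewrite /entry /= nth_rcons ks. Qed.

Lemma entry_end (R : realType) (s : seq (option (cinterval R))) :
  entry s (size s).+1 = Some (pinfty_interval R).
Proof. by rewrite /entry /= nth_rcons ltnn eqxx. Qed.

(** Dropping nulls shifts positions, so the induction runs over [s] itself, after transitivity has
    extended the order to non-adjacent entries. *)
Lemma ordered_nth (R : realType) (s : seq (option (cinterval R))) i j X Y :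
  ordered s -> (i < j)%N -> nth None s i = Some X -> nth None s j = Some Y ->
  interval_le X Y.
Proof.
rewrite /ordered (sorted_pairwise (@interval_le_trans R)).
have mem_pmap t k Z : nth None t k = Some Z ->
    forall p : pred (cinterval R), all p (pmap id t) -> p Z.
  elim: t k => [|[V|] t IHt] [|k] //=.
  - by move=> [->] p /andP[].
  - by move=> /IHt pZ p /andP[_ /pZ].
  - exact: IHt.
elim: s i j => [|Z s IHs] [|i] [|j] //.
- move=> /= + _ ZX sY; rewrite ZX /= => /andP[all_s _].
  exact: mem_pmap sY _ all_s.
- move=> /= ord_s ij; apply: (IHs i j) => //.
  by case: Z ord_s => [Z /andP[]|].
Qed.

Section Starts.
Variables (R : realType) (Task : Type) (I : instance R Task).
Local Notation n := (ntasks I).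

Definition window (k : nat) : cinterval R :=
  nth (ninfty_interval R) (windows I) k.

Definition wstart (k : nat) : R := fine (istart (window k)).

Definition wend (k : nat) : R := fine (iend (window k)).

(** Index [k] counts from 0 and refers to entry [k.+1]. A null entry gets the meaningless value
    0. *)
Definition start (S : seq (option (cinterval R))) (k : nat) : R :=
  fine (istart (odflt (ninfty_interval R) (entry S k.+1))).

Definition allocation_at (x : nat -> R) : seq (option (cinterval R)) :=
  mkseq (fun k => Some (slot_at (x k))) n.

Lemma windowE k :
  (k < n)%N -> window k = CInterval (wstart k)%:E (wend k)%:E.
Proof.
move=> kn; rewrite /wstart /wend /window.
have := all_nthP (ninfty_interval R) (windowsP I) k.
rewrite size_tuple => /(_ kn).
by case: nth => s e /= /and3P[/fineK -> /fineK ->].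
Qed.

Lemma nth_window_seq k :
  (k < n)%N -> nth None (window_seq I) k = Some (window k).
Proof. by move=> kn; rewrite (nth_map (ninfty_interval R)) ?size_tuple. Qed.

Lemma entry_window k :
  (k < n)%N -> entry (window_seq I) k.+1 = Some (window k).
Proof. by move=> kn; rewrite entryS ?nth_window_seq ?size_map ?size_tuple. Qed.

Lemma window_homo : ordered_instance I -> forall i j, (i <= j < n)%N ->
  wstart i <= wstart j /\ wend i <= wend j.
Proof.
move=> ordI i j /andP[]; rewrite leq_eqVlt => /predU1P[->|ij] jn; first by [].
have i_n := ltn_trans ij jn.
have := ordered_nth ordI ij (nth_window_seq i_n) (nth_window_seq jn).
by rewrite !windowE // /interval_le /= !lee_fin => /andP.
Qed.

Lemma allocation_slot S k : valid_allocation I S -> (k < n)%N ->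
  entry S k.+1 <> None ->
  [/\ entry S k.+1 = Some (slot_at (start S k)),
      wstart k <= start S k & start S k + 1 <= wend k].
Proof.
move=> [_ fits _] kn; rewrite /start; case eS : (entry S k.+1) => [X|] // _.
have [|/is_slotP[x ->]] := fits k.+1 X _ _ eS (entry_window kn); first by lia.
by move/points_slot_sub; rewrite windowE //= !lee_fin => -[].
Qed.

(** Non-overlap as a linear alternative, the separation hypothesis of [earliest_fits]. *)
Lemma allocation_sep S i j : valid_allocation I S -> (i < n)%N -> (j < n)%N ->
  i != j -> entry S i.+1 <> None -> entry S j.+1 <> None ->
  start S i + 1 <= start S j \/ start S j + 1 <= start S i.
Proof.
move=> vS i_n jn ij Si Sj.
have [eSi _ _] := allocation_slot vS i_n Si.
have [eSj _ _] := allocation_slot vS jn Sj.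
have [_ _ disj] := vS.
have {disj} := disj i.+1 j.+1 _ _ ltac:(lia) ltac:(lia) _ eSi eSj.
rewrite overlap_slot => disj.
case: (leP (start S i + 1) (start S j)) => [|ji]; first by left.
case: (leP (start S j + 1) (start S i)) => [|ij']; first by right.
by case: disj => //; lia.
Qed.

(** The order alone gives [start S i <= start S j]; disjointness widens this to a full unit, even
    across a null entry. *)
Lemma allocation_ordered S i j : valid_allocation I S -> ordered S ->
  (i < j < n)%N -> entry S i.+1 <> None -> entry S j.+1 <> None ->
  start S i + 1 <= start S j.
Proof.
move=> vS ordS /andP[ij jn] Si Sj; have i_n := ltn_trans ij jn.
have [eSi _ _] := allocation_slot vS i_n Si.
have [eSj _ _] := allocation_slot vS jn Sj.
have [sizeS _ _] := vS; rewrite !entryS ?sizeS // in eSi eSj.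
have := ordered_nth ordS ij eSi eSj; rewrite interval_le_slot.
by case: (allocation_sep vS i_n jn _ Si Sj); [lia | lra | lra].
Qed.

Lemma entry_allocation_at x k :
  (k < n)%N -> entry (allocation_at x) k.+1 = Some (slot_at (x k)).
Proof. by move=> kn; rewrite entryS ?size_mkseq // nth_mkseq. Qed.

(** Consecutive gaps add up, which yields both disjointness and order. Serves both branches of
    Near. *)
Lemma allocation_at_solution (x : nat -> R) :
  (forall k, (k < n)%N -> wstart k <= x k /\ x k + 1 <= wend k) ->
  (forall k, (k.+1 < n)%N -> x k + 1 <= x k.+1) ->
  solution I (allocation_at x) /\ ordered (allocation_at x).
Proof.
move=> fits step.
have incr i j : (i < j < n)%N -> x i + 1 <= x j.
  move=> /andP[]; elim: j => // j IHj; rewrite ltnS leq_eqVlt.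
  case/predU1P => [->|ij] jn; first exact: step.
  by have := IHj ij (ltnW jn); have := step j jn; lra.
split; last first.
  rewrite /ordered /allocation_at /mkseq map_comp (map_pK (f := id)) //.
  apply: pairwise_sorted; rewrite pairwise_map.
  apply/(pairwiseP 0%N) => i j; rewrite !inE size_iota => i_n jn ij.
  rewrite /= interval_le_slot !nth_iota // !add0n.
  by have := incr i j ltac:(lia); lra.
split=> [|[|i] // i_n]; last by rewrite entry_allocation_at.
split=> [|[|i] // X w i_n|[|i] // [|j] // X Y i_n jn ij].
- by rewrite size_mkseq.
- rewrite entry_allocation_at // entry_window // => -[<-] [<-].
  split; first by apply/is_slotP; exists (x i).
  by apply/points_slot_sub; rewrite windowE //= !lee_fin; apply: fits.
- rewrite !entry_allocation_at // => -[<-] [<-] /overlap_slot.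
  have [lt_ij|lt_ji|eq_ij] := ltngtP i j; last by rewrite eq_ij in ij.
  - by have := incr i j ltac:(lia); lra.
  - by have := incr j i ltac:(lia); lra.
Qed.

(** Windows are finite and the sentinel [-oo] is neutral for [maxe], so the extended-real scan is a
    real recursion. *)
Lemma leftmostE : leftmost I = allocation_at (earliest wstart).
Proof.
apply: (@eq_from_nth _ None) => [|k].
  by rewrite size_map size_scanl size_tuple size_mkseq.
rewrite size_map size_scanl size_tuple => kn.
rewrite nth_mkseq // (nth_map (ninfty_interval R)) ?size_scanl ?size_tuple //.
congr Some; rewrite nth_scanl ?size_tuple //.
elim: k kn => [|k IHk] kn.
  rewrite (take_nth (ninfty_interval R)) ?size_tuple // take0 /=.
  by rewrite -/(window 0) windowE // /leftmost_step /= maxeNy -EFinD.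
rewrite (take_nth (ninfty_interval R)) ?size_tuple // foldl_rcons IHk 1?ltnW //.
by rewrite -/(window _) windowE // /leftmost_step /= -EFin_max -EFinD.
Qed.

End Starts.

(** * The two branches of Near *)

Theorem mainTheorem5 (R : realType) (Task : Type) (I : instance R Task)
    (S : seq (option (cinterval R))) (r : nat)
    (hstate : insert_state I S r) (hfeas : feasible I)
    (hI : ordered_instance I) (hS : ordered S) :
  near_ordered_solution I S r (near_allocation I S r).
Proof.
have [vS r_n nullS] := hstate; have [sizeS _ _] := vS.
have [F [vF allF]] := hfeas.
(* From here [r] counts from 0: [entry S r.+1] is the null entry and [entry S r] its predecessor, a
   sentinel if [r = 0]. *)
case: r hstate r_n nullS => // r _ /= lt_rn nullS.
pose a := wstart I; pose b := wend I; pose L := earliest a; pose s := start S.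
have nonnull k : (k < ntasks I)%N -> k != r -> entry S k.+1 <> None.
  by move=> kn kr /(nullS k.+1 kn)[]; lia.
(* The solution [F] may be unordered; only its separated starts are used. *)
have L_fits k : (k < ntasks I)%N -> L k + 1 <= b k.
  apply: (earliest_fits (f := start F) (window_homo hI)) => [i i_n|i j i_n jn ij].
    by have [] := allocation_slot vF i_n (allF i.+1 i_n).
  by apply: (allocation_sep vF) => //; apply: allF.
have eS k : (k < ntasks I)%N -> k != r ->
    [/\ entry S k.+1 = Some (slot_at (s k)), a k <= s k & s k + 1 <= b k].
  by move=> kn kr; apply: allocation_slot (nonnull k kn kr).
have s_ord i j : (i < j < ntasks I)%N -> i != r -> j != r -> s i + 1 <= s j.
  by move=> ij ir jr; apply: (allocation_ordered vS) => //; apply: nonnull; lia.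
rewrite /near_allocation leftmostE /= entry_allocation_at //.
case: ifPn => [le_SL|].
  have [solL ordL] := allocation_at_solution
    (fun k kn => conj (earliest_ge a k) (L_fits k kn))
    (fun k _ => earliest_step a k).
  split=> //; rewrite entry_allocation_at //=.
  have [/eqP last_r|r1n] := boolP (r.+1 == ntasks I).
    by rewrite last_r -sizeS entry_end /ointerval_le /interval_le /= !leey.
  have lt_r1n : (r.+1 < ntasks I)%N by lia.
  have [-> a_s _] := eS r.+1 lt_r1n ltac:(lia).
  rewrite /ointerval_le interval_le_slot.
  have [a_homo _] := window_homo hI (i := r) (j := r.+1) ltac:(lia).
  case: r lt_rn nullS nonnull eS s_ord le_SL r1n lt_r1n a_s a_homo
    => [|r] lt_rn nullS nonnull eS s_ord le_SL r1n lt_r1n a_s a_homo /=.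
    exact: le_trans a_homo a_s.
  (* The null index is now [r.+1]. The other argument of the maximum obeys
     [L r + 1 <= s r + 1 <= s r.+2], by minimality of [L] on the prefix. *)
  rewrite ge_max (le_trans a_homo a_s) /=.
  apply: le_trans (s_ord r r.+2 _ _ _); [rewrite lerD2r | lia..].
  apply: earliest_le => i ir; last by apply: s_ord; lia.
  by have [] := eS i ltac:(lia) ltac:(lia).
(* For [r = 0] the predecessor is [[-oo, -oo]], so the test cannot fail. Otherwise the null index
   becomes [r.+1]. *)
case: r lt_rn nullS nonnull eS s_ord => [|r] lt_rn nullS nonnull eS s_ord.
  by rewrite /ointerval_le /interval_le /= !leNye.
have [eSr a_sr sr_b] := eS r (ltnW lt_rn) ltac:(lia).
rewrite eSr /ointerval_le interval_le_slot -ltNge -/a -/L => lt_Ls.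
(* Start times of [N]: task [r] moves to [L r] and hands its slot [s r] to task [r.+1]. *)
pose x k := if (k <= r)%N then L k else if k == r.+1 then s r else s k.
have -> : take r.+1 (allocation_at I (earliest (wstart I)))
    ++ Some (slot_at (s r)) :: drop r.+2 S = allocation_at I x.
  apply: (@eq_from_nth _ None) => [|k].
    by rewrite size_cat /= size_takel ?size_mkseq ?size_drop ?sizeS; lia.
  rewrite size_cat /= size_takel ?size_mkseq ?size_drop ?sizeS; last by lia.
  move=> k_lt; have kn : (k < ntasks I)%N by lia.
  rewrite nth_cat size_takel ?size_mkseq; last by lia.
  rewrite [RHS]nth_mkseq // /x.
  rewrite ltnS; case: leqP => [kr|rk]; first by rewrite nth_take // nth_mkseq.
  case: eqVneq => [->|kr]; first by rewrite subnn.
  have -> : (k - r.+1 = (k - r.+2).+1)%N by lia.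
  rewrite /= nth_drop subnKC; last by lia.
  by rewrite -entryS ?sizeS //; have [] := eS k kn kr.
have x_r : x r.+1 = s r by rewrite /x ltnn eqxx.
have x_tail k : (r.+1 < k)%N -> x k = s k.
  by move=> rk; rewrite /x !ifF //; apply/negbTE; lia.
have [solN ordN] : solution I (allocation_at I x) /\ ordered (allocation_at I x).
  apply: allocation_at_solution => k kn.
    rewrite /x; case: leqP => [kr|rk].
      by split; [apply: earliest_ge | apply: L_fits].
    case: eqVneq => [->|kr]; last by have [] := eS k kn kr.
    (* The inherited slot fits: [a r.+1 <= L r.+1 < s r] and [s r + 1 <= b r <= b r.+1]. *)
    have a_Lr : a r.+1 <= L r.+1 := earliest_ge a r.+1.
    have [_ b_homo] : a r <= a r.+1 /\ b r <= b r.+1.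
      by apply: (window_homo hI); lia.
    by rewrite -/a -/b; split; lra.
  have [kr|rk] := leqP k.+1 r; first by rewrite /x kr ltnW //; apply: earliest_step.
  (* The seam between [L] and [S]: [L r + 1 <= L r.+1 < s r]. *)
  have [->|kr] := eqVneq k r.
    by rewrite x_r /x leqnn; have := earliest_step a r; rewrite -/L; lra.
  rewrite [x k.+1]x_tail; last by lia.
  have [->|kr1] := eqVneq k r.+1; first by rewrite x_r; apply: s_ord; lia.
  by rewrite x_tail; [apply: s_ord | ]; lia.
split=> //; rewrite entry_allocation_at // x_r.
  by rewrite eSr /ointerval_le interval_le_slot.
have [last_r|r1n] := eqVneq r.+2 (ntasks I).
  by rewrite last_r -sizeS entry_end /ointerval_le /interval_le /= !leey.
have [-> _ _] := eS r.+2 ltac:(lia) ltac:(lia).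
rewrite /ointerval_le interval_le_slot.
by have := s_ord r r.+2 ltac:(lia) ltac:(lia) ltac:(lia); lra.
Qed.
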